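(* Let $N > 2$ be an integer. The following statements are equivalent: (i) $N$ is prime; (ii) for all $(i,j) \in \mathcal{D}_{j \leq i}$: $\mathbf{1}_{\mathbb{Z}\setminus N\mathbb{Z}}(X^N_{i,j}) = 0$; (iii) for all $(i,j) \in \mathcal{D}_{j \leq i}$: $\left|\mathbf{1}_{\mathbb{Z}\setminus N\mathbb{Z}}(X^N_{i,j}) - \mathbf{1}_{\mathbb{Z}\setminus N\mathbb{Z}}(Y^N_{i,j})\right| = 1$. Moreover, if $N$ is prime, then for all $(i,j) \in \mathcal{D}_{j \leq i}$: $\mathbf{1}_{\mathbb{Z}\setminus N\mathbb{Z}}(Y^N_{i,j}) = 1$.
   Context: $\mathcal{D}_{j\le i}$ is the set of integer pairs $(i,j)$ with $0 \le j \le i \le N-1$. For $(i,j)\in\mathcal{D}_{j\le i}$, let $S^N_{i,j} = \binom{i}{j} + \binom{N-1-j}{N-1-i}$ and $W^N_{i,j} = \binom{i}{j} - \binom{N-1-j}{N-1-i}$, and define $X^N_{i,j}=\frac{1-(-1)^{i+j}}{2}S^N_{i,j}+\frac{1+(-1)^{i+j}}{2}W^N_{i,j}$ and $Y^N_{i,j}=\frac{1+(-1)^{i+j}}{2}S^N_{i,j}+\frac{1-(-1)^{i+j}}{2}W^N_{i,j}$; equivalently $X^N_{i,j}=\binom{i}{j}-(-1)^{i+j}\binom{N-1-j}{N-1-i}$ and $Y^N_{i,j}=\binom{i}{j}+(-1)^{i+j}\binom{N-1-j}{N-1-i}$. For an integer $x$, $\mathbf{1}_{\mathbb{Z}\setminus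 N\mathbb{Z}}(x)$ equals $0$ if $N$ divides $x$, and $1$ otherwise. *)

(* Defs.v *)
From mathcomp Require Import all_boot all_order all_algebra.

Set Implicit Arguments.
Unset Strict Implicit.
Unset Printing Implicit Defensive.

Import GRing.Theory.
Local Open Scope ring_scope.

Definition domD (N i j : nat) : bool := (0 <= j <= i)%N && (i <= N - 1)%N.

(* On domD, the truncated nat subtractions N - 1 - j and N - 1 - i are exact. *)
Definition bin_sum (N i j : nat) : int :=
  'C(i, j)%:Z + 'C(N - 1 - j, N - 1 - i)%:Z.

Definition bin_diff (N i j : nat) : int :=
  'C(i, j)%:Z - 'C(N - 1 - j, N - 1 - i)%:Z.

(* (1 - (-1)^k) / 2 and (1 + (-1)^k) / 2; both integer divisions are exact. *)
Definition odd_coef (k : nat) : int := ((1 - (-1) ^+ k) %/ 2)%Z.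

Definition even_coef (k : nat) : int := ((1 + (-1) ^+ k) %/ 2)%Z.

Definition binX (N i j : nat) : int :=
  odd_coef (i + j) * bin_sum N i j + even_coef (i + j) * bin_diff N i j.

Definition binY (N i j : nat) : int :=
  even_coef (i + j) * bin_sum N i j + odd_coef (i + j) * bin_diff N i j.

(* Indicator function of the complement of N Z in Z. *)
Definition ind_nonmult (N : nat) (x : int) : int :=
  if (N%:Z %| x)%Z then 0 else 1.

(* Main.v *)
Require Import Defs.
From mathcomp Require Import all_boot all_order all_algebra.
From mathcomp Require Import zify ring.

(** Since X and Y are 'C(i, j) -/+ (-1)^(i + j) * 'C(N-1-j, i-j), everything
    rests on comparing the two binomials modulo N.

    For N prime, N - 1 - j is congruent to -(j + 1), and the upper-negation
    rule 'C(-(j+1), k) = (-1)^k * 'C(j+k, k) survives reduction modulo N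
    because the denominators 1, ..., N - 1 are units
    ([prime_bin_upper_negation]). So X vanishes modulo N, and Y is congruent
    to 2 * 'C(i, j), which is prime to N because N is odd and i < N.

    Conversely, look only at the row i = N - 1, where X and Y are
    'C(N-1, j) -/+ 1. Either condition makes every entry of row N - 1 of
    Pascal's triangle congruent to 1 or -1 modulo N, with an uncontrolled sign
    in the case of (iii). For odd N this forces primality
    ([prime_of_bin_row_signs]): if N = p * m with p prime and m > 1, then
    'C(N, p) = m * 'C(N-1, p-1) is a multiple of m and also a sum of two signs
    modulo m; as m > 2, the signs cancel, so N divides 'C(N, p), so p divides
    'C(N-1, p-1), which is 1 or -1 modulo p.
    Even N is excluded by a single entry: X = 2 at (N-1, 0) contradicts (ii),
    while X = N and Y = 0 at (N/2, N/2 - 1) contradict (iii). *)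

Set Implicit Arguments.
Unset Strict Implicit.
Unset Printing Implicit Defensive.

Import GRing.Theory.
Local Open Scope ring_scope.

Lemma odd_coefE k : odd_coef k = (odd k)%:Z.
Proof. by rewrite /odd_coef -signr_odd; case: (odd k). Qed.

Lemma even_coefE k : even_coef k = (~~ odd k)%:Z.
Proof. by rewrite /even_coef -signr_odd; case: (odd k). Qed.

Lemma binXE N i j :
  binX N i j = 'C(i, j)%:Z - (-1) ^+ (i + j) * 'C(N - 1 - j, N - 1 - i)%:Z.
Proof.
rewrite /binX /bin_sum /bin_diff odd_coefE even_coefE -signr_odd.
by case: (odd _) => /=; ring.
Qed.

Lemma binYE N i j :
  binY N i j = 'C(i, j)%:Z + (-1) ^+ (i + j) * 'C(N - 1 - j, N - 1 - i)%:Z.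
Proof.
rewrite /binY /bin_sum /bin_diff odd_coefE even_coefE -signr_odd.
by case: (odd _) => /=; ring.
Qed.

Lemma ind_nonmult_eq0 N x : (ind_nonmult N x = 0) <-> (N%:Z %| x)%Z.
Proof. by rewrite /ind_nonmult; case: ifP. Qed.

Lemma ind_nonmult_eq1 N x : (ind_nonmult N x = 1) <-> ~~ (N%:Z %| x)%Z.
Proof. by rewrite /ind_nonmult; case: ifP. Qed.

Lemma ind_nonmult_dist1 N x y :
  (`|ind_nonmult N x - ind_nonmult N y| = 1)
    <-> (N%:Z %| x)%Z (+) (N%:Z %| y)%Z.
Proof. by rewrite /ind_nonmult; do 2 case: ifP. Qed.

(** Upper negation 'C(-(j+1), k) = (-1)^k * 'C(j+k, k), reduced modulo p. With
    D k the difference below, the absorption identities give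
    (k+1) * D (k+1) = p * 'C(p-1-j, k) - (j+k+1) * D k, and k+1 is prime
    to p. *)
Lemma prime_bin_upper_negation p j k : prime p -> (j + k < p)%N ->
  (p%:Z %| 'C(p - 1 - j, k)%:Z - (-1) ^+ k * 'C(j + k, k)%:Z)%Z.
Proof.
move=> p_pr; elim: k => [|k IHk] lt_jk_p; first by rewrite !bin0 subrr dvdz0.
have {}IHk := IHk ltac:(lia).
have co_pk : coprimez p%:Z k.+1%:Z.
  by rewrite coprimezE /= prime_coprime // gtnNdvd //; lia.
rewrite -(Gauss_dvdzr _ co_pk).
have absA : k.+1%:Z * 'C(p - 1 - j, k.+1)%:Z
            = (p%:Z - (j + k).+1%:Z) * 'C(p - 1 - j, k)%:Z.
  have -> : p%:Z - (j + k).+1%:Z = (p - 1 - j - k)%N%:Z by lia.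
  by rewrite -!PoszM mul_bin_left.
have absB : k.+1%:Z * 'C(j + k.+1, k.+1)%:Z = (j + k).+1%:Z * 'C(j + k, k)%:Z.
  by rewrite -!PoszM addnS -mul_bin_diag.
rewrite mulrBr absA mulrCA absB exprS.
rewrite (_ : _ - _ = p%:Z * 'C(p - 1 - j, k)%:Z - (j + k).+1%:Z *
  ('C(p - 1 - j, k)%:Z - (-1) ^+ k * 'C(j + k, k)%:Z)); last by ring.
by apply: rpredB; [apply: dvdz_mulr | apply: dvdz_mull].
Qed.

Lemma prime_dvd_binX p i j : prime p -> domD p i j -> (p%:Z %| binX p i j)%Z.
Proof.
move=> p_pr /andP[/andP[_ le_ji] le_ip].
have p_gt1 := prime_gt1 p_pr.
have := @prime_bin_upper_negation p j (i - j) p_pr ltac:(lia).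
rewrite binXE subnKC // bin_sub //.
rewrite -(@bin_sub (p - 1 - j) (p - 1 - i)); last by lia.
rewrite (_ : p - 1 - j - (p - 1 - i) = i - j)%N; last by lia.
have -> : (-1) ^+ (i + j) = (-1) ^+ (i - j) :> int.
  by rewrite -signr_odd oddD -oddB // signr_odd.
move: (i - j)%N => k /(dvdz_mull ((-1) ^+ k)).
by rewrite mulrBr signrMK -rpredN opprB.
Qed.

Lemma prime_dvd_fact p n : prime p -> (p %| n`!)%N -> (p <= n)%N.
Proof.
move=> p_pr; elim: n => [|n IHn]; first by rewrite fact0 Euclid_dvd1.
by rewrite factS Euclid_dvdM // => /orP[/dvdn_leq->|/IHn/leqW].
Qed.

(** X + Y = 2 * 'C(i, j), so an odd prime above i cannot divide both. *)
Lemma prime_ndvd_binY p i j :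
  prime p -> (2 < p)%N -> domD p i j -> ~~ (p%:Z %| binY p i j)%Z.
Proof.
move=> p_pr p_gt2 Dij; have dvX := prime_dvd_binX p_pr Dij.
have /andP[/andP[_ le_ji] le_ip] := Dij.
apply/negP => dvY; have := rpredD dvX dvY.
have -> : binX p i j + binY p i j = (2 * 'C(i, j))%N%:Z.
  by rewrite binXE binYE mul2n -addnn PoszD; ring.
rewrite dvdzE /= Euclid_dvdM // gtnNdvd //=.
move=> /(dvdn_mulr (j`! * (i - j)`!)).
by rewrite bin_fact // => /(prime_dvd_fact p_pr); lia.
Qed.

(** Reducing modulo m = N / p makes the two unknown signs s and t at p - 1 and
    p cancel; after that N itself divides 'C(N, p). *)
Lemma prime_of_bin_row_signs N : (1 < N)%N -> odd N ->
  (forall j, (j <= N - 1)%N ->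
     exists b : bool, (N%:Z %| 'C(N - 1, j)%:Z - (-1) ^+ b)%Z) ->
  prime N.
Proof.
move=> N_gt1 oddN row.
have [p p_pr /dvdnP[m defN]] : exists2 p, prime p & (p %| N)%N.
  by exists (pdiv N); rewrite ?pdiv_prime ?pdiv_dvd.
have p_gt1 := prime_gt1 p_pr.
have [m_le1 | m_gt1] := leqP m 1.
  have m1 : m = 1%N by case: m defN m_le1 => [|[|m]] //; lia.
  by rewrite defN m1 mul1n.
have odd_m : odd m by move: oddN; rewrite defN oddM => /andP[].
have lt_pN : (p < N)%N by rewrite defN ltn_Pmull //; lia.
have [s dv_s] := row p.-1 ltac:(lia).
have [t dv_t] := row p ltac:(lia).
have sum_bin : 'C(N - 1, p.-1)%:Z + 'C(N - 1, p)%:Z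
               = m%:Z * 'C(N - 1, p.-1)%:Z.
  rewrite -PoszM -PoszD; congr Posz.
  have := binS (N - 1) p.-1; have := mul_bin_diag N p.-1.
  rewrite subn1 !prednK; try lia.
  by rewrite addnC => absorb <-; nia.
have Em : N%:Z = m%:Z * p%:Z by rewrite -PoszM -defN.
have dv_mN : (m%:Z %| N%:Z)%Z by rewrite Em dvdz_mulr.
have dv_pN : (p%:Z %| N%:Z)%Z by rewrite Em dvdz_mull.
have sum_signs : (-1) ^+ s + (-1) ^+ t = 0 :> int.
  have : (m%:Z %| (-1) ^+ s + (-1) ^+ t)%Z.
    rewrite (_ : _ + _ = m%:Z * 'C(N - 1, p.-1)%:Z
      - (('C(N - 1, p.-1)%:Z - (-1) ^+ s) + ('C(N - 1, p)%:Z - (-1) ^+ t)));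
      last by rewrite -sum_bin; ring.
    apply: rpredB; first exact: dvdz_mulr.
    exact: (dvdz_trans dv_mN (rpredD dv_s dv_t)).
  have m_ndvd2 : ~~ (m %| 2)%N by rewrite gtnNdvd //; case: m odd_m m_gt1
    {defN sum_bin Em dv_mN} => [|[|[|]]].
  by case: (s); case: (t); rewrite // dvdzE //= (negPf m_ndvd2).
have : (N%:Z %| m%:Z * 'C(N - 1, p.-1)%:Z)%Z.
  rewrite -sum_bin (_ : _ + _ = ('C(N - 1, p.-1)%:Z - (-1) ^+ s)
    + ('C(N - 1, p)%:Z - (-1) ^+ t) + ((-1) ^+ s + (-1) ^+ t)); last by ring.
  by rewrite sum_signs addr0 rpredD.
rewrite Em dvdz_mul2l; last by lia.
move=> dv_bin; have := rpredB dv_bin (dvdz_trans dv_pN dv_s).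
rewrite opprB addrC subrK dvdzE abszX exp1n dvdn1 => /eqP.
lia.
Qed.

(** On the last row the second binomial is 'C(N-1-j, 0) = 1, so divisibility of
    X or of Y pins the entry 'C(N-1, j) to a sign. *)
Lemma last_row_sign N j : (j <= N - 1)%N ->
    (N%:Z %| binX N (N - 1) j)%Z || (N%:Z %| binY N (N - 1) j)%Z ->
  exists b : bool, (N%:Z %| 'C(N - 1, j)%:Z - (-1) ^+ b)%Z.
Proof.
move=> le_jN; rewrite binXE binYE subnn bin0 mulr1 -signr_odd.
case/orP=> dv; first by exists (odd (N - 1 + j)).
by exists (~~ odd (N - 1 + j)); rewrite signrN opprK.
Qed.

Lemma domD_last_row N j : (j <= N - 1)%N -> domD N (N - 1) j.
Proof. by move=> le_jN; rewrite /domD le_jN leqnn. Qed.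

Lemma prime_of_dvd_binX N : (2 < N)%N ->
  (forall i j, domD N i j -> (N%:Z %| binX N i j)%Z) -> prime N.
Proof.
move=> N_gt2 dvX; apply: prime_of_bin_row_signs; first by lia.
  have := dvX _ _ (domD_last_row (leq0n _)).
  rewrite binXE subnn !bin0 mulr1 addn0 -signr_odd oddB ?addbT /=; last by lia.
  by case: (odd N) => //; rewrite dvdzE /= gtnNdvd.
move=> j le_jN; apply: last_row_sign => //.
by rewrite dvX ?domD_last_row.
Qed.

Lemma prime_of_dvd_binX_xor_binY N : (2 < N)%N ->
  (forall i j, domD N i j -> (N%:Z %| binX N i j)%Z (+) (N%:Z %| binY N i j)%Z) ->
  prime N.
Proof.
move=> N_gt2 xorXY; apply: prime_of_bin_row_signs; first by lia.
  apply: contraT => evenN; set h := N./2.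
  have defN : N = h.*2 by rewrite even_halfK.
  (* i + j = N - 1 is odd and both binomials equal 'C(h, h - 1) = h, whence
     X = 2 * h = N and Y = 0. *)
  have := xorXY h h.-1; rewrite /domD => /(_ ltac:(lia)).
  rewrite binXE binYE (_ : N - 1 - h.-1 = h)%N; last by lia.
  rewrite (_ : N - 1 - h = h.-1)%N; last by lia.
  rewrite -signr_odd (_ : odd (h + h.-1) = true); last by lia.
  rewrite (_ : 'C(h, h.-1) = h); last by rewrite -subn1 bin_sub ?bin1; lia.
  by rewrite expr1 !mulN1r opprK subrr dvdz0 -PoszD addnn -defN dvdzz.
move=> j le_jN; apply: last_row_sign => //.
by have := xorXY _ _ (domD_last_row le_jN); do 2 case: (_ %| _)%Z.
Qed.

Theorem theorem4p3 (N : nat) (hN : (2 < N)%N) :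
  (prime N <->
     (forall i j : nat, domD N i j -> ind_nonmult N (binX N i j) = 0))
  /\ (prime N <->
     (forall i j : nat, domD N i j ->
        `|ind_nonmult N (binX N i j) - ind_nonmult N (binY N i j)| = 1))
  /\ (prime N ->
     forall i j : nat, domD N i j -> ind_nonmult N (binY N i j) = 1).
Proof.
split; [split | split; [split |]].
- by move=> N_pr i j Dij; apply/ind_nonmult_eq0/prime_dvd_binX.
- move=> indX; apply: prime_of_dvd_binX => // i j Dij.
  exact/ind_nonmult_eq0/indX.
- move=> N_pr i j Dij; apply/ind_nonmult_dist1.
  by rewrite prime_dvd_binX // (negPf (prime_ndvd_binY _ _ _)).
- move=> indXY; apply: prime_of_dvd_binX_xor_binY => // i j Dij.
  exact/ind_nonmult_dist1/indXY.
- by move=> N_pr i j Dij; apply/ind_nonmult_eq1/prime_ndvd_binY.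
Qed.
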